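(* Let $T>0$ and let $u\in C^{1,2}\left((0,T]\times\overline{\mathbb{R}^{N+1}_+}\right)\cap C\left([0,T]\times\overline{\mathbb{R}^{N+1}_+}\right)$ satisfy $$\partial_t u=\mathcal L u \ \text{ in } (0,T]\times \overline{\mathbb{R}^{N+1}_+},\qquad u(0,z)=0 \ \text{ for } z\in\mathbb{R}^{N+1}_+,$$ together with the Neumann boundary condition $\lim_{y\to 0^+}y^cD_yu(t,x,y)=0$ for all $t\in(0,T]$, $x\in\mathbb{R}^N$. If there are constants $\beta,C>0$ such that $|u(t,z)|\le Ce^{\beta|z|^2}$ for all $(t,z)\in[0,T]\times\overline{\mathbb{R}^{N+1}_+}$, then $u\equiv 0$.
   Context: $N\ge 0$ is an integer, $\mathbb{R}^{N+1}_+=\{z=(x,y):x\in\mathbb{R}^N,\ y>0\}$, $\overline{\mathbb{R}^{N+1}_+}=\{y\ge 0\}$ and $|z|^2=|x|^2+y^2$. Let $c\in\mathbb{R}$ with $c+1>0$ and $a\in\mathbb{R}^N$ with $|a|<1$, and set $$\mathcal L=\Delta_x+2a\cdot\nabla_xD_y+D_{yy}+\frac{c}{y}D_y .$$ $C^{1,2}(I\times\overline{\mathbb{R}^{N+1}_+})$, for an interval $I$, is the set of functions $u(t,z)$ such that $u$, $\partial_tu$ and all first and second order derivatives of $u$ in $z$ exist and are continuous on $I\times\overline{\mathbb{R}^{N+1}_+}$ (up to $y=0$). At $y=0$, $\mathcal L u$ is understood as the limit as $y\to0^+$. *)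

(* Defs.v *)
From HB Require Import structures.
From mathcomp Require Import all_boot all_order all_algebra.
From mathcomp Require Import all_classical all_reals all_analysis.
Set Implicit Arguments.
Unset Strict Implicit.
Unset Printing Implicit Defensive.
Import Order.TTheory GRing.Theory Num.Theory.
Import numFieldNormedType.Exports.
Local Open Scope classical_set_scope.
Local Open Scope ring_scope.

(* [derivable] and [derive] of the library, with the difference quotient taken
   only along increments that stay in D: two-sided at interior points of D,
   one-sided at a boundary point when the direction is transversal. *)
Section DerivativeWithin.
Context {R : realType} {V : lmodType R}.
Implicit Types (D : set V) (f : V -> R) (p v : V).

Definition diff_quotient f p v (h : R) : R := h^-1 * (f (h *: v + p) - f p).

Definition increments D p v : set R := [set h | D (h *: v + p)].

Definition derivable_in D f p v : Prop :=
  cvg (diff_quotient f p v @ within (increments D p v) 0^').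

Definition derive_in D f p v : R :=
  lim (diff_quotient f p v @ within (increments D p v) 0^').

End DerivativeWithin.

Section HalfSpace.
Context {R : realType} {N : nat}.

(* Points z = (x, y) of R^(N+1) are pairs in 'rV[R]_N * R. *)
Definition closed_half_space : set ('rV[R]_N * R) := [set z | 0 <= z.2].

(* The matrix norm of the library is the sup norm; the Euclidean one is needed. *)
Definition enorm (x : 'rV[R]_N) : R := Num.sqrt (\sum_(i < N) x ord0 i ^+ 2).

Definition sqnorm (z : 'rV[R]_N * R) : R := enorm z.1 ^+ 2 + z.2 ^+ 2.

(* The coordinate directions: [Some i] is x_i and [None] is y. *)
Definition basis_vec (k : option 'I_N) : 'rV[R]_N * R :=
  if k is Some i then (delta_mx ord0 i, 0) else (0, 1).

Definition Dz (k : option 'I_N) (f : 'rV[R]_N * R -> R) (z : 'rV[R]_N * R) : R :=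
  derive_in closed_half_space f z (basis_vec k).

Definition Dz_exists (k : option 'I_N) (f : 'rV[R]_N * R -> R)
    (z : 'rV[R]_N * R) : Prop :=
  derivable_in closed_half_space f z (basis_vec k).

Definition Dt (I : set R) (u : R -> 'rV[R]_N * R -> R) (t : R)
    (z : 'rV[R]_N * R) : R :=
  derive_in I (u^~ z) t 1.

Definition Dt_exists (I : set R) (u : R -> 'rV[R]_N * R -> R) (t : R)
    (z : 'rV[R]_N * R) : Prop :=
  derivable_in I (u^~ z) t 1.

Definition continuous_tz (I : set R) (u : R -> 'rV[R]_N * R -> R) : Prop :=
  {within I `*` closed_half_space,
    continuous (fun p : R * ('rV[R]_N * R) => u p.1 p.2)}.

Definition C12 (I : set R) (u : R -> 'rV[R]_N * R -> R) : Prop :=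
  [/\ continuous_tz I u,
      (forall t z, I t -> closed_half_space z -> Dt_exists I u t z)
        /\ continuous_tz I (Dt I u),
      forall k,
        (forall t z, I t -> closed_half_space z -> Dz_exists k (u t) z)
          /\ continuous_tz I (fun t => Dz k (u t)) &
      forall k l,
        (forall t z, I t -> closed_half_space z ->
           Dz_exists k (Dz l (u t)) z)
          /\ continuous_tz I (fun t => Dz k (Dz l (u t)))].

(* Meaningful for y > 0 only. *)
Definition Lop (c : R) (a : 'rV[R]_N) (f : 'rV[R]_N * R -> R)
    (z : 'rV[R]_N * R) : R :=
  \sum_(i < N) Dz (Some i) (Dz (Some i) f) z
  + 2 * \sum_(i < N) a ord0 i * Dz (Some i) (Dz None f) z
  + Dz None (Dz None f) z
  + c / z.2 * Dz None f z.

(* At y = 0 the value of L u is its limit as y -> 0+. *)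
Definition parabolic_eq (I : set R) (c : R) (a : 'rV[R]_N)
    (u : R -> 'rV[R]_N * R -> R) : Prop :=
  forall t, I t -> forall x : 'rV[R]_N,
    (forall y : R, 0 < y -> Dt I u t (x, y) = Lop c a (u t) (x, y))
    /\ Lop c a (u t) (x, y) @[y --> 0^'+] --> Dt I u t (x, 0).

Definition neumann (I : set R) (c : R) (u : R -> 'rV[R]_N * R -> R) : Prop :=
  forall t, I t -> forall x : 'rV[R]_N,
    y `^ c * Dz None (u t) (x, y) @[y --> 0^'+] --> (0 : R).

End HalfSpace.

(* Main.v *)
Require Import Defs.
From mathcomp Require Import all_boot all_order all_algebra.
From mathcomp Require Import all_classical all_reals all_analysis.
From mathcomp Require Import ring lra.
Import Order.TTheory GRing.Theory Num.Theory.
Import numFieldNormedType.Exports.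
Local Open Scope classical_set_scope.
Local Open Scope ring_scope.
Set Implicit Arguments.
Unset Strict Implicit.
Unset Printing Implicit Defensive.

(* Suppose s u > 0 somewhere (s = 1 or -1) and compare with the Gaussian
   phi = exp (k (t - ts) + g(t) |z|^2), which outgrows u when g >= 2 beta.  With
   eps > 0, s u - eps phi is nonpositive outside a compact box, so a positive
   value forces a positive maximum, attained at some (t0, z0) with t0 > ts.
   There the left time derivative is >= 0.  If y0 > 0, the second order part
   sum_i (D_i + a_i D_y)^2 + (1 - |a|^2) D_yy and D_y of the difference are <= 0
   and 0.  If y0 = 0, the Neumann condition and the equation force D_y u = 0 on
   the whole boundary, hence L u = Delta_x u + (1 + c) D_yy u there, and the
   difference has D_ii <= 0, D_yy <= 0.  Both cases contradict
   d_t phi > L phi, which holds on a time interval of length 1 / (64 beta)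
   independent of ts; iterating over such intervals covers [0, T]. *)

(** * A second order Taylor inequality on a segment *)

Section Line.
Context {R : realType}.
Implicit Types (f : R -> R) (d m : R).

(** The mean value theorem is used twice: on [f1], giving [m * r <= f1 r], and on
    [f s - m / 2 * s ^+ 2], whose derivative is [f1 s - m * s]. Derivatives are required only inside
    the interval, so the segment may start on the boundary of the half-space. *)
Lemma second_order_lower_bound f (f1 f2 : R -> R) d m :
  0 < d ->
  {within `[0, d], continuous f} -> {within `[0, d], continuous f1} ->
  (forall s : R, s \in `]0, d[ -> is_derive s 1 f (f1 s)) ->
  (forall s : R, s \in `]0, d[ -> is_derive s 1 f1 (f2 s)) ->
  f1 0 = 0 -> (forall s : R, s \in `]0, d[ -> m <= f2 s) ->
  f 0 + m / 2 * d ^+ 2 <= f d.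
Proof.
move=> d0 cf cf1 df df1 f10 mf2.
pose g s := f s - m / 2 * s ^+ 2.
have dg s : s \in `]0, d[ -> is_derive s 1 g (f1 s - m * s).
  move=> sd; have := df s sd => ?.
  rewrite /g; apply: is_derive_eq.
  by rewrite /GRing.scale /=; field.
have cg : {within `[0, d], continuous g}.
  move=> x; apply: cvgB; first exact: cf.
  apply: cvgM; first exact: cvg_cst.
  have cid : {within `[0, d], continuous (fun s : R => s)}.
    by apply: continuous_subspaceT => y; exact: cvg_id.
  exact: (cvgM (cid x) (cid x)).
have [r rd gE] := MVT d0 dg cg.
have [r0 rltd] : 0 < r /\ r < d by move: rd; rewrite in_itv /= => /andP.
have sub1 s : s \in `]0, r[ -> s \in `]0, d[.
  by rewrite !in_itv /= => /andP[-> /lt_trans->].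
have cr : {within `[0, r], continuous f1}.
  apply: continuous_subspaceW cf1 => x /=.
  by rewrite !in_itv /= => /andP[-> /le_trans->]//; exact: ltW.
have [s sr f1E] := MVT r0 (fun x xr => df1 x (sub1 x xr)) cr.
have ms := mf2 s (sub1 s sr).
have : 0 <= (f1 r - m * r) * (d - 0).
  rewrite subr0 mulr_ge0 ?(ltW d0)// subr_ge0.
  by move: f1E; rewrite f10 !subr0 => ->; rewrite ler_wpM2r // ltW.
by rewrite -gE /g expr0n /= mulr0 subr0 subr_ge0; lra.
Qed.

End Line.

(** * Relative, one-sided and ordinary difference quotients *)

Section DiffQuotient.
Context {R : realType} {V : lmodType R}.
Implicit Types (D : set V) (f g : V -> R) (p v : V).

Lemma diff_quotient_right D f p v (L : R) :
  (\forall h \near (0 : R)^'+, D (h *: v + p)) ->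
  diff_quotient f p v h @[h --> within (increments D p v) 0^'] --> L ->
  diff_quotient f p v h @[h --> 0^'+] --> L.
Proof.
move=> Dh; apply: cvg_trans; apply: cvg_app => A /= AD.
have A0 : \forall h \near (0 : R)^'+, h != 0 -> D (h *: v + p) -> A h.
  have AD' : nbhs (0 : R) (fun h => h != 0 -> D (h *: v + p) -> A h) by exact: AD.
  by apply: filterS AD' => h + _; exact.
near=> h; have h0 : 0 < h by near: h; exact: nbhs_right_gt.
have hn0 : h != 0 by rewrite gt_eqF.
have : D (h *: v + p) by near: h.
by move: hn0; near: h.
Unshelve. all: by end_near. Qed.

(** Serves for first derivatives at a maximum, in particular for the time derivative when the
    maximum may sit at the right end of the time window. *)
Lemma diff_quotient_left D f p v (L : R) :
  (\forall h \near (0 : R)^'-, D (h *: v + p)) ->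
  diff_quotient f p v h @[h --> within (increments D p v) 0^'] --> L ->
  diff_quotient f p v h @[h --> 0^'-] --> L.
Proof.
move=> Dh; apply: cvg_trans; apply: cvg_app => A /= AD.
have A0 : \forall h \near (0 : R)^'-, h != 0 -> D (h *: v + p) -> A h.
  have AD' : nbhs (0 : R) (fun h => h != 0 -> D (h *: v + p) -> A h) by exact: AD.
  by apply: filterS AD' => h + _; exact.
near=> h; have h0 : h < 0 by near: h; exact: nbhs_left_lt.
have hn0 : h != 0 by rewrite lt_eqF.
have : D (h *: v + p) by near: h.
by move: hn0; near: h.
Unshelve. all: by end_near. Qed.

Lemma diff_quotient_lin D f g p v (s e L M : R) :
  diff_quotient f p v h @[h --> within (increments D p v) 0^'] --> L ->
  diff_quotient g p v h @[h --> within (increments D p v) 0^'] --> M ->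
  diff_quotient (fun q => s * f q - e * g q) p v h
    @[h --> within (increments D p v) 0^'] --> s * L - e * M.
Proof.
move=> fL gM.
rewrite (_ : diff_quotient _ _ _ =
   (fun h => s * diff_quotient f p v h - e * diff_quotient g p v h)); last first.
  by apply/funext => h; rewrite /diff_quotient; ring.
by apply: cvgB; apply: cvgM => //; exact: cvg_cst.
Qed.

Lemma diff_quotient_derive f p v (L : R) :
  is_derive (0 : R) 1 (fun s : R => f (s *: v + p)) L ->
  diff_quotient f p v h @[h --> 0^'] --> L.
Proof.
move=> [df dE].
move: df; rewrite /derivable => /cvg_ex[l lE].
have : 'D_1 (fun s : R => f (s *: v + p)) 0 = l by exact: cvg_lim lE.
rewrite dE => ->.
apply: cvg_trans lE; apply: near_eq_cvg; near=> h.
have hE : h *: (1 : R) = h := mulr1 h.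
by rewrite /diff_quotient /= hE addr0 scale0r add0r.
Unshelve. all: by end_near. Qed.

(** Passage to [is_derive] along a line, which makes the mean value theorem available. *)
Lemma derive_diff_quotient f p v (s L : R) :
  diff_quotient f (s *: v + p) v h @[h --> 0^'] --> L ->
  is_derive s 1 (fun r : R => f (r *: v + p)) L.
Proof.
move=> fL.
have fL' : h^-1 *: (f ((h *: 1 + s) *: v + p) - f (s *: v + p))
    @[h --> (0 : R)^'] --> L.
  apply: cvg_trans fL; apply: near_eq_cvg; near=> h.
  have hE : h *: (1 : R) = h := mulr1 h.
  by rewrite /diff_quotient hE scalerDl addrA.
by split; [apply/cvg_ex; exists L | exact: cvg_lim fL'].
Unshelve. all: by end_near. Qed.

End DiffQuotient.

(** * First and second order conditions at a maximum over the closed half-space *)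

Section SecondOrderMax.
Context {R : realType} {N : nat}.
Notation point := ('rV[R]_N * R)%type.
Notation H := (@closed_half_space R N).
Notation E := (@basis_vec R N).

(** A relation, not a function: combinations of the solution and the Gaussian then come with
    explicit derivatives, without evaluating [lim]. *)
Definition is_Dz (k : option 'I_N) (f g : point -> R) : Prop :=
  forall z, H z ->
    diff_quotient f z (E k) h @[h --> within (increments H z (E k)) 0^'] --> g z.

(* Points around which H contains a segment in the direction k. *)
Definition free_in (k : option 'I_N) (z : point) : Prop :=
  if k is Some _ then 0 <= z.2 else 0 < z.2.

Lemma free_in_closed k (z : point) : free_in k z -> H z.
Proof. by case: k => [i|] //= /ltW. Qed.

Lemma snd_step k (h : R) (z : point) :
  (h *: E k + z).2 = (if k is Some _ then z.2 else h + z.2).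
Proof.
by case: k => [i|] /=; rewrite ?scaler0 ?add0r // /GRing.scale /= mulr1.
Qed.

Lemma free_near k (z : point) :
  free_in k z -> \forall h \near (0 : R), H (h *: E k + z).
Proof.
move=> kz.
suff [d d0 dP] : exists2 d : R, d < 0 & forall h, d < h -> H (h *: E k + z).
  by near=> h; apply: dP; near: h; exact: lt_nbhsr.
case: k kz => [i|] /= z0; [exists (-1) | exists (- z.2)]; rewrite ?oppr_lt0 //;
  move=> h hd; rewrite /closed_half_space /=; first by rewrite scaler0 add0r.
by rewrite /GRing.scale /= mulr1; lra.
Unshelve. all: by end_near. Qed.

(** At a point free in direction [k] all small increments stay in [H], so the relative limit is an
    ordinary two-sided one. *)
Lemma Dz_derive k (f g : point -> R) (z : point) (s : R) :
  is_Dz k f g -> free_in k (s *: E k + z) ->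
  is_derive s 1 (fun r : R => f (r *: E k + z)) (g (s *: E k + z)).
Proof.
move=> fg kz; apply: derive_diff_quotient.
have zH := free_near kz.
apply: cvg_trans (fg _ (free_in_closed kz)); apply: cvg_app => A AD.
have AD' : nbhs (0 : R) (fun h => h != 0 -> H (h *: E k + (s *: E k + z)) -> A h).
  exact: AD.
suff : nbhs (0 : R) (fun h => h != 0 -> A h) by [].
by apply: filterS2 AD' zH => h + Hh hn; exact.
Qed.

Lemma step_continuous k (z : point) : continuous (fun s : R => s *: E k + z).
Proof.
move=> s; apply: cvgD; last exact: cvg_cst.
by apply: cvgZr_tmp; exact: cvg_id.
Qed.

Lemma within_step k (f : point -> R) (z : point) (A : set R) :
  {within H, continuous f} -> (forall s, A s -> H (s *: E k + z)) ->
  {within A, continuous (fun s : R => f (s *: E k + z))}.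
Proof.
move=> /subspace_continuousP cf AH; apply/subspace_continuousP => s As.
have cs : (r *: E k + z) @[r --> within A (nbhs s)] -->
    within H (nbhs (s *: E k + z)).
  move=> B HB.
  have nB : nbhs s (fun r => H (r *: E k + z) -> B (r *: E k + z)).
    exact: (@step_continuous k z s _ HB).
  suff : nbhs s (fun r => A r -> B (r *: E k + z)) by [].
  by apply: filterS nB => r + Ar; apply; exact: AH.
exact: cvg_comp cs (cf _ (AH _ As)).
Qed.

Section Max.
Variables (f : point -> R) (f1 : option 'I_N -> point -> R)
  (f2 : option 'I_N -> option 'I_N -> point -> R).
Hypotheses (df : forall k, is_Dz k f (f1 k))
  (df1 : forall k l, is_Dz k (f1 l) (f2 k l)).
Hypotheses (cf : {within H, continuous f})
  (cf1 : forall k, {within H, continuous (f1 k)})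
  (cf2 : forall k l, {within H, continuous (f2 k l)}).

(** [second_order_lower_bound] along [s -> z + s b e_k]. The speed [b], of either sign, lets one [d]
    serve for displacements [d] in [x_i] and [d * b] in [y]. Only the open segment must be free, so
    [z] may be a boundary point. *)
Lemma directional_lower_bound k (b d m : R) (z : point) :
  0 < d -> (forall s : R, s \in `]0, d[ -> free_in k ((s * b) *: E k + z)) ->
  H z -> H ((d * b) *: E k + z) -> f1 k z = 0 ->
  (forall s : R, s \in `]0, d[ -> m <= b ^+ 2 * f2 k k ((s * b) *: E k + z)) ->
  f z + m / 2 * d ^+ 2 <= f ((d * b) *: E k + z).
Proof.
move=> d0 fr Hz Hd f1z mf2.
have Hs (s : R) : s \in `[0, d] -> H ((s * b) *: E k + z).
  rewrite in_itv /= => /andP[]; rewrite le_eqVlt => /predU1P[<- _|s0].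
    by rewrite mul0r scale0r add0r.
  rewrite le_eqVlt => /predU1P[->//|sd]; apply: (@free_in_closed k); apply: fr.
  by rewrite in_itv /= s0 sd.
have cb (g : point -> R) : {within H, continuous g} ->
    {within `[0, d], continuous (fun s : R => g ((s * b) *: E k + z))}.
  move=> cg; have := @within_step k g z [set s * b | s in `[0, d]] cg.
  move=> /(_ _)/subspace_continuousP cg'; apply/subspace_continuousP => s sd.
  have cs : r * b @[r --> within `[0, d] (nbhs s)] -->
      within [set s * b | s in `[0, d]] (nbhs (s * b)).
    move=> B HB.
    have nB : nbhs s (fun r => [set s * b | s in `[0, d]] (r * b) -> B (r * b)).
      exact: (@mulrr_continuous R b s _ HB).
    suff : nbhs s (fun r => r \in `[0, d] -> B (r * b)) by [].
    by apply: filterS nB => r + rd; apply; exists r.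
  apply: cvg_comp cs (cg' _ _ _) => //; last by exists s.
  by move=> _ [r rd <-]; exact: Hs.
have db (g g' : point -> R) s : is_Dz k g g' -> s \in `]0, d[ ->
    is_derive s 1 (fun s : R => g ((s * b) *: E k + z))
      (b * g' ((s * b) *: E k + z)).
  move=> dg sd; have := Dz_derive dg (fr s sd) => dgs.
  have dm : is_derive s 1 (fun s : R => s * b) b.
    by apply: is_derive_eq; rewrite /GRing.scale /= mulr1 mulr0 add0r.
  have := is_derive1_comp (g := fun r : R => r * b) dgs dm.
  by rewrite mulrC.
have := @second_order_lower_bound R (fun s => f ((s * b) *: E k + z))
  (fun s => b * f1 k ((s * b) *: E k + z))
  (fun s => b ^+ 2 * f2 k k ((s * b) *: E k + z)) d m d0.
rewrite mul0r scale0r add0r; apply => //.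
- exact: cb.
- by move=> s; apply: cvgM; [exact: cvg_cst|exact: cb].
- by move=> s sd; exact: db.
- move=> s sd; have := db _ _ s (@df1 k k) sd => ?.
  by apply: is_derive_eq; rewrite /GRing.scale /=; ring.
- by rewrite f1z mulr0.
Qed.

Lemma near_plane (g : point -> R) (i : 'I_N) (z : point) (e : R) :
  {within H, continuous g} -> 0 < z.2 -> 0 < e ->
  exists2 d : R, 0 < d & forall s r : R, `|s| < d -> `|r| < d ->
    0 < r + z.2 /\ `|g (s *: E (Some i) + (r *: E None + z)) - g z| < e.
Proof.
move=> /subspace_continuousP cg z0 e0.
have Hz : H z by exact: ltW.
have /cvgrPdist_lt /(_ e e0) := cg z Hz => gz.
have gz' : nbhs z (fun q => H q -> `|g z - g q| < e) by exact: gz.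
pose step (q : R * R) : point := q.1 *: E (Some i) + (q.2 *: E None + z).
have cstep : step q @[q --> (0, 0)] --> z.
  rewrite (_ : z = step (0, 0)) ?/step /=; last by rewrite !scale0r !add0r.
  apply: cvgD; first by apply: cvgZr_tmp; exact: cvg_fst.
  apply: cvgD; last exact: cvg_cst.
  by apply: cvgZr_tmp; exact: cvg_snd.
have /nbhs_ballP[d /= d0 dP] :
  nbhs ((0, 0) : R * R) (fun q => H (step q) -> `|g z - g (step q)| < e).
  exact: cstep gz'.
(* The cap [z.2] keeps the whole square of displacements in the open half-space. *)
exists (Num.min d z.2); first by rewrite lt_min d0.
move=> s r; rewrite !lt_min => /andP[sd _] /andP[rd rz].
have rz2 : 0 < r + z.2.
  by move: rz; rewrite ltr_norml => /andP[+ _]; lra.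
split=> //; rewrite distrC; apply: (dP (s, r)).
  by split; rewrite /ball /= sub0r normrN.
rewrite /step /closed_half_space /= scaler0 add0r.
by rewrite /GRing.scale /= mulr1 ltW.
Qed.

Section AtMax.
Variable z : point.
Hypotheses (Hz : H z) (zmax : forall q, H q -> f q <= f z).

Lemma Dz_at_max k : free_in k z -> f1 k z = 0.
Proof.
move=> kz; have zH := free_near kz.
apply/eqP; rewrite eq_le; apply/andP; split.
- have zHr : \forall h \near (0 : R)^'+, H (h *: E k + z) by exact: cvg_within.
  apply: (cvgr_to_le (diff_quotient_right zHr (df Hz))); near=> h.
  have h0 : 0 < h by near: h; exact: nbhs_right_gt.
  rewrite /diff_quotient pmulr_rle0 ?invr_gt0// subr_le0; apply: zmax.
  by near: h.
- have zHl : \forall h \near (0 : R)^'-, H (h *: E k + z) by exact: cvg_within.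
  apply: (cvgr_to_ge (diff_quotient_left zHl (df Hz))); near=> h.
  have h0 : h < 0 by near: h; exact: nbhs_left_lt.
  rewrite /diff_quotient nmulr_rge0 ?invr_lt0// subr_le0; apply: zmax.
  by near: h.
Unshelve. all: by end_near. Qed.

(** A positive second derivative would stay above half its value on a short segment and push [f]
    above its maximum. The segment goes in the positive direction only, so [y] is allowed at the
    boundary; there [f1 k z = 0] does not follow from maximality and has to be assumed. *)
Lemma Dz2_at_max k : f1 k z = 0 -> f2 k k z <= 0.
Proof.
move=> f1z; rewrite leNgt; apply/negP => f2z.
have stepH (s : R) : 0 <= s -> H (s *: E k + z).
  move=> s0; rewrite /closed_half_space /=.
  case: k {f1z f2z} => [i|] /=; first by rewrite scaler0 add0r.
  by rewrite /GRing.scale /= mulr1 addr_ge0.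
have f2c : f2 k k (s *: E k + z) @[s --> within [set s | 0 <= s] (nbhs (0 : R))]
    --> f2 k k (0 *: E k + z).
  have /subspace_continuousP := @within_step k _ z [set s : R | 0 <= s] (@cf2 k k) stepH.
  by apply; exact: lexx.
rewrite scale0r add0r in f2c.
have f2z2 : 0 < f2 k k z / 2 by lra.
have /cvgrPdist_lt /(_ _ f2z2) f2n := f2c.
have /nbhs_ballP[e /= e0 eP] : nbhs (0 : R) (fun s => 0 <= s ->
    `|f2 k k z - f2 k k (s *: E k + z)| < f2 k k z / 2) by exact: f2n.
have d0 : 0 < e / 2 by lra.
have := @directional_lower_bound k 1 (e / 2) (f2 k k z / 2) z d0.
rewrite mulr1 expr1n => /(_ _ Hz (stepH _ (ltW d0)) f1z).
have fr (s : R) : s \in `]0, (e / 2)[ -> free_in k ((s * 1) *: E k + z).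
  rewrite in_itv /= => /andP[s0 _]; case: (k) => [i|] /=.
    by rewrite scaler0 add0r.
  by rewrite /GRing.scale /= !mulr1 ltr_pwDl.
have f2d (s : R) : s \in `]0, (e / 2)[ ->
    f2 k k z / 2 <= 1 * f2 k k ((s * 1) *: E k + z).
  rewrite in_itv /= => /andP[s0 se]; rewrite mulr1 mul1r.
  have : `|f2 k k z - f2 k k (s *: E k + z)| < f2 k k z / 2.
    by apply: eP => //=; [rewrite /ball /= sub0r normrN gtr0_norm //; lra|exact: ltW].
  by rewrite ltr_norml => /andP[_]; lra.
move=> /(_ fr f2d); have := zmax (stepH _ (ltW d0)).
have : 0 < f2 k k z / 2 / 2 * (e / 2) ^+ 2 by rewrite mulr_gt0 ?exprn_gt0 //; lra.
lra.
Qed.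

(* The second difference of [f] over the rectangle spanned by [d e_i] and
   [d b e_y] is [d^2 b D_i D_y f] at a point of the rectangle, so neither the
   symmetry of the second derivatives nor a chain rule is needed. *)
Lemma mixed_difference (i : 'I_N) (b d : R) :
  0 < d -> 0 < z.2 -> 0 < d * b + z.2 ->
  exists s r : R, [/\ s \in `]0, d[, r \in `]0, d[ &
    f (d *: E (Some i) + ((d * b) *: E None + z)) - f ((d * b) *: E None + z)
    - (f (d *: E (Some i) + z) - f z)
    = d ^+ 2 * b * f2 (Some i) None (s *: E (Some i) + ((r * b) *: E None + z))].
Proof.
move=> d0 z0 dbz.
have pos (r : R) : r \in `[0, d] -> 0 < r * b + z.2.
  rewrite in_itv /= => /andP[r0 rd].
  have [b0|b0] := leP 0 b; first by rewrite ltr_wpDl// mulr_ge0.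
  by apply: lt_le_trans dbz _; rewrite lerD2r ler_nM2r.
have frN (q : point) (r : R) : q.2 = z.2 -> r \in `[0, d] ->
    free_in None ((r * b) *: E None + q).
  move=> q2 /pos; rewrite /free_in snd_step q2; exact.
(* The mean value theorem acts first in [y], on the [x_i]-increment of [f], then in [x_i], on
   [D_y f]. This order yields [D_i D_y], the mixed derivative that occurs in [Lop]. *)
pose G (r : R) := f ((r * b) *: E None + (d *: E (Some i) + z))
                  - f ((r * b) *: E None + z).
pose dG (r : R) := b * (f1 None ((r * b) *: E None + (d *: E (Some i) + z))
                  - f1 None ((r * b) *: E None + z)).
have dn (q : point) (r : R) : q.2 = z.2 -> r \in `[0, d] ->
    is_derive r 1 (fun r : R => f ((r * b) *: E None + q))
      (b * f1 None ((r * b) *: E None + q)).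
  move=> q2 rd; have dfr := Dz_derive (@df None) (frN q r q2 rd).
  have dm : is_derive r 1 (fun r : R => r * b) b.
    by apply: is_derive_eq; rewrite /GRing.scale /= mulr1 mulr0 add0r.
  by have := is_derive1_comp (g := fun r : R => r * b) dfr dm; rewrite mulrC.
have dG' (r : R) : r \in `[0, d] -> is_derive r 1 G (dG r).
  move=> rd; have q2 : (d *: E (Some i) + z).2 = z.2 := snd_step (Some i) d z.
  have d1 := dn _ r q2 rd; have d2 := dn _ r erefl rd.
  by apply: is_derive_eq; rewrite /dG mulrBr.
have sub (r : R) : r \in `]0, d[ -> r \in `[0, d] by exact: subset_itv_oo_cc.
have cG : {within `[0, d], continuous G}.
  by apply: derivable_within_continuous => r rd; have [] := dG' r rd.
have [r rd GE] := MVT d0 (fun r rd => dG' r (sub r rd)) cG.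
set q := (r * b) *: E None + z.
have q0 : 0 < q.2 by have := frN z r erefl (sub r rd).
have frS (s : R) : free_in (Some i) (s *: E (Some i) + q).
  by rewrite /free_in snd_step ltW.
have ds (s : R) : is_derive s 1 (fun s : R => f1 None (s *: E (Some i) + q))
    (f2 (Some i) None (s *: E (Some i) + q)).
  exact: Dz_derive (@df1 (Some i) None) (frS s).
have cs : {within `[0, d], continuous (fun s : R => f1 None (s *: E (Some i) + q))}.
  by apply: derivable_within_continuous => s sd; have [] := ds s.
have [s sd sE] := MVT d0 (fun s _ => ds s) cs.
exists s, r; split => //; rewrite -/q.
move: sE GE; rewrite /G /dG !subr0 !mul0r !scale0r !add0r.
rewrite (addrCA ((r * b) *: E None)) -/q => ->.
rewrite (addrCA ((d * b) *: E None)) => GE.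
by transitivity (b * (f2 (Some i) None (s *: E (Some i) + q) * d) * d); [rewrite -GE|]; ring.
Qed.

(** The left side is formally the second derivative along [e_i + b e_y]. If it were positive, the
    lower bounds along two sides of a small rectangle plus the mixed difference would put [f] at the
    opposite corner above [f z]. *)
Lemma Dz2_mixed_at_max (i : 'I_N) (b : R) : 0 < z.2 ->
  f2 (Some i) (Some i) z + 2 * b * f2 (Some i) None z
  + b ^+ 2 * f2 None None z <= 0.
Proof.
move=> z0; rewrite leNgt; apply/negP; set Q := _ + _ => Q0.
have f1i : f1 (Some i) z = 0 by exact: Dz_at_max.
have f1y : f1 None z = 0 by exact: Dz_at_max.
(* Errors [Q / 8] in the three terms cost [Q / 16 + Q / 16 + Q / 8 = Q / 4] times [d ^+ 2], against
   a gain of [Q / 2] times [d ^+ 2]. *)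
have e0 : 0 < Q / 8 by lra.
have cM (k l : option 'I_N) (m : R) : {within H, continuous (fun q => m * f2 k l q)}.
  by move=> q; apply: cvgM; [exact: cvg_cst|exact: cf2].
have [d1 d10 d1P] := near_plane i (cM (Some i) (Some i) 1) z0 e0.
have [d2 d20 d2P] := near_plane i (cM (Some i) None b) z0 e0.
have [d3 d30 d3P] := near_plane i (cM None None (b ^+ 2)) z0 e0.
pose D := Num.min d1 (Num.min d2 d3).
have D0 : 0 < D by rewrite !lt_min d10 d20.
have [D1 [D2 D3]] : D <= d1 /\ D <= d2 /\ D <= d3.
  by rewrite !ge_min !lexx !orbT.
have b1 : 0 < 1 + `|b| by rewrite ltr_pwDl.
(* The divisor makes both [d] and [d * b] smaller than [D] in absolute value. *)
pose d := D / 2 / (1 + `|b|).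
have d0 : 0 < d by rewrite !divr_gt0.
have dD : d * (1 + `|b|) < D by rewrite /d divfK ?gt_eqF//; lra.
have small (s : R) : s \in `[0, d] -> `|s| < D /\ `|s * b| < D.
  rewrite in_itv /= => /andP[s0 sd]; rewrite normrM (ger0_norm s0).
  have ? := normr_ge0 b.
  by split; nra.
have oc (s : R) : s \in `]0, d[ -> s \in `[0, d] by exact: subset_itv_oo_cc.
have dd : d \in `[0, d] by rewrite in_itv /= lexx ltW.
have D00 : `|0 : R| < D by rewrite normr0.
have [dsm dbsm] := small d dd.
have dbz : 0 < d * b + z.2.
  by have [] := d1P 0 (d * b) (lt_le_trans D00 D1) (lt_le_trans dbsm D1).
have A : f z + (f2 (Some i) (Some i) z - Q / 8) / 2 * d ^+ 2
    <= f (d *: E (Some i) + z).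
  have fr (s : R) : free_in (Some i) (s *: E (Some i) + z).
    by rewrite /free_in snd_step ltW.
  have := @directional_lower_bound (Some i) 1 d
    (f2 (Some i) (Some i) z - Q / 8) z d0.
  rewrite mulr1 expr1n; apply => //.
  - exact: (@free_in_closed (Some i) _ (fr d)).
  move=> s /oc /small[sD _]; rewrite mulr1.
  have [_] := d1P s 0 (lt_le_trans sD D1) (lt_le_trans D00 D1).
  by rewrite scale0r add0r ltr_norml => /andP[+ _]; lra.
have frN (s : R) : s \in `[0, d] -> free_in None ((s * b) *: E None + z).
  move=> /small[_ sbD]; rewrite /free_in snd_step.
  by have [] := d1P 0 (s * b) (lt_le_trans D00 D1) (lt_le_trans sbD D1).
have B : f z + (b ^+ 2 * f2 None None z - Q / 8) / 2 * d ^+ 2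
    <= f ((d * b) *: E None + z).
  apply: directional_lower_bound => //.
  - by move=> s /oc; exact: frN.
  - exact: (@free_in_closed None _ (frN d dd)).
  move=> s /oc /small[_ sbD].
  have [_] := d3P 0 (s * b) (lt_le_trans D00 D3) (lt_le_trans sbD D3).
  by rewrite scale0r add0r ltr_norml => /andP[+ _]; lra.
have [s [r [/oc/small[sD _] /oc/small[_ rD] ME]]] := mixed_difference i d0 z0 dbz.
have [_] := d2P s (r * b) (lt_le_trans sD D2) (lt_le_trans rD D2).
rewrite ltr_norml => /andP[bM _].
have M : f (d *: E (Some i) + z) + f ((d * b) *: E None + z) - f z
   + (b * f2 (Some i) None z - Q / 8) * d ^+ 2
   <= f (d *: E (Some i) + ((d * b) *: E None + z)).
  set W := f2 (Some i) None _ in bM ME.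
  have : (b * f2 (Some i) None z - Q / 8) * d ^+ 2 <= b * W * d ^+ 2.
    by rewrite ler_pM2r ?exprn_gt0 //; lra.
  have WE : d ^+ 2 * b * W = b * W * d ^+ 2 by ring.
  by move: ME; rewrite WE; lra.
have : f (d *: E (Some i) + ((d * b) *: E None + z)) <= f z.
  apply: zmax; apply: (@free_in_closed (Some i)).
  by rewrite /free_in !snd_step ltW.
have : 0 < Q * d ^+ 2 by rewrite mulr_gt0 ?exprn_gt0.
move: A B M; rewrite /Q; lra.
Qed.

End AtMax.

End Max.
End SecondOrderMax.

(** * The Gaussian at a fixed time and its space derivatives *)

Section Barrier.
Context {R : realType} {N : nat}.
Notation point := ('rV[R]_N * R)%type.
Notation H := (@closed_half_space R N).
Notation E := (@basis_vec R N).
Implicit Types (k l : option 'I_N) (z : point).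

Definition coordinate k z : R := if k is Some i then z.1 ord0 i else z.2.

Lemma sqnormE z : sqnorm z = \sum_(i < N) z.1 ord0 i ^+ 2 + z.2 ^+ 2.
Proof.
by rewrite /sqnorm /enorm sqr_sqrtr// sumr_ge0// => i _; rewrite sqr_ge0.
Qed.

Lemma coordinate_step k l (h : R) z :
  coordinate l (h *: E k + z) = coordinate l z + h * (k == l)%:R.
Proof.
case: k l => [i|] [j|] /=.
- by rewrite !mxE eqxx /= addrC eq_sym.
- by rewrite scaler0 add0r mulr0 addr0.
- by rewrite !mxE mulr0 add0r addr0.
- by rewrite /GRing.scale /= addrC.
Qed.

Lemma sqnorm_step k (h : R) z :
  sqnorm (h *: E k + z) = sqnorm z + 2 * h * coordinate k z + h ^+ 2.
Proof.
rewrite !sqnormE.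
have cS i : (h *: E k + z).1 ord0 i = z.1 ord0 i + h * (k == Some i)%:R.
  exact: (coordinate_step k (Some i)).
have cN : (h *: E k + z).2 = z.2 + h * (k == None)%:R.
  exact: (coordinate_step k None).
rewrite cN; under eq_bigr do rewrite cS.
case: k {cS cN} => [i|] /=.
  rewrite (bigD1 i) //= [in RHS](bigD1 i) //= eqxx.
  rewrite (eq_bigr (fun j => z.1 ord0 j ^+ 2)); first by rewrite mulr1; ring.
  move=> j ji; rewrite (_ : Some i == Some j = false) ?mulr0 ?addr0//.
  by apply/eqP => -[ij]; rewrite ij eqxx in ji.
rewrite (eq_bigr (fun j => z.1 ord0 j ^+ 2)); first by rewrite mulr1; ring.
by move=> j _; rewrite mulr0 addr0.
Qed.

Lemma continuous_coordinate k : continuous (coordinate k).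
Proof.
case: k => [i|] z /=; last exact: cvg_snd.
exact: (continuous_comp (f := fst) (g := fun x : 'rV[R]_N => x ord0 i)
  (@cvg_fst _ _ _ _ _) (@coord_continuous R 1 N ord0 i z.1)).
Qed.

Lemma sqnorm_continuous : continuous (@sqnorm R N).
Proof.
rewrite (_ : @sqnorm R N = fun z =>
   \sum_(i < N) coordinate (Some i) z * coordinate (Some i) z
   + coordinate None z * coordinate None z).
  move=> z; apply: cvgD; last by apply: cvgM; exact: continuous_coordinate.
  apply: cvg_big => [|i _]; first exact: add_continuous.
  by apply: cvgM; exact: continuous_coordinate.
by apply/funext => z; rewrite sqnormE.
Qed.

(** [A] and [g] are the values at one time of the two time-dependent coefficients of the barrier. *)
Definition gauss (A g : R) z : R := expR (A + g * sqnorm z).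
Definition gauss1 (A g : R) k z : R := 2 * g * coordinate k z * gauss A g z.
Definition gauss2 (A g : R) k l z : R :=
  (4 * g ^+ 2 * coordinate k z * coordinate l z + 2 * g * (k == l)%:R) * gauss A g z.

Section Fixed.
Variables A g : R.

Let gauss_line k z : is_derive (0 : R) 1 (fun s : R => gauss A g (s *: E k + z))
  (gauss1 A g k z).
Proof.
rewrite (_ : (fun s : R => _) =
  fun s => expR (A + g * (sqnorm z + 2 * s * coordinate k z + s ^+ 2))); last first.
  by apply/funext => s; rewrite /gauss sqnorm_step.
have d : is_derive (0 : R) 1
    (fun s : R => A + g * (sqnorm z + 2 * s * coordinate k z + s ^+ 2)) (2 * g * coordinate k z).
  by apply: is_derive_eq; rewrite /GRing.scale /=; ring.
have := is_derive1_comp (is_derive_expR _) d.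
by rewrite /gauss1 /gauss mulr0 mul0r expr0n /= !addr0 mulrC.
Qed.

Lemma gauss_Dz k : is_Dz k (gauss A g) (gauss1 A g k).
Proof.
move=> z _; apply: cvg_within_filter; apply: diff_quotient_derive.
exact: gauss_line.
Qed.

Lemma gauss1_Dz k l : is_Dz k (gauss1 A g l) (gauss2 A g k l).
Proof.
move=> z _; apply: cvg_within_filter; apply: diff_quotient_derive.
rewrite (_ : (fun s : R => _) = fun s =>
    (2 * g * (coordinate l z + s * (k == l)%:R)) * gauss A g (s *: E k + z)); last first.
  by apply/funext => s; rewrite /gauss1 coordinate_step.
have := gauss_line k z => ?.
apply: is_derive_eq.
by rewrite scale0r add0r /gauss2 /gauss1 /GRing.scale /=; ring.
Qed.

Lemma gauss_continuous : continuous (gauss A g).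
Proof.
move=> z; apply: continuous_comp; last exact: continuous_expR.
apply: cvgD; first exact: cvg_cst.
by apply: cvgM; [exact: cvg_cst|exact: sqnorm_continuous].
Qed.

Lemma gauss1_continuous k : continuous (gauss1 A g k).
Proof.
move=> z; apply: cvgM; last exact: gauss_continuous.
by apply: cvgM; [exact: cvg_cst|exact: continuous_coordinate].
Qed.

Lemma gauss2_continuous k l : continuous (gauss2 A g k l).
Proof.
move=> z; apply: cvgM; last exact: gauss_continuous.
apply: cvgD; last exact: cvg_cst.
apply: cvgM; last exact: continuous_coordinate.
by apply: cvgM; [exact: cvg_cst|exact: continuous_coordinate].
Qed.

End Fixed.

End Barrier.

(** * Sign of the second order part at an interior maximum *)

Section EllipticMax.
Context {R : realType} {N : nat}.
Notation point := ('rV[R]_N * R)%type.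
Notation H := (@closed_half_space R N).

Lemma sum_sqr_le1 (a : 'rV[R]_N) :
  enorm a < 1 -> \sum_(i < N) a ord0 i ^+ 2 <= 1.
Proof.
move=> a1; have ge0 : 0 <= \sum_(i < N) a ord0 i ^+ 2.
  by apply: sumr_ge0 => i _; exact: sqr_ge0.
by rewrite -(sqr_sqrtr ge0) -/(enorm a) expr_le1 ?sqrtr_ge0// ltW.
Qed.

(** [Dz2_mixed_at_max] with [b = a_i], summed over [i], uses up [|a|^2 D_yy]; the remaining
    [(1 - |a|^2) D_yy] is nonpositive because [|a| < 1]. *)
Lemma elliptic_at_max (f : point -> R) (f1 : option 'I_N -> point -> R)
    (f2 : option 'I_N -> option 'I_N -> point -> R) (a : 'rV[R]_N) (z : point) :
  (forall k, is_Dz k f (f1 k)) -> (forall k l, is_Dz k (f1 l) (f2 k l)) ->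
  {within H, continuous f} -> (forall k, {within H, continuous (f1 k)}) ->
  (forall k l, {within H, continuous (f2 k l)}) ->
  enorm a < 1 -> 0 < z.2 -> (forall q, H q -> f q <= f z) ->
  \sum_(i < N) f2 (Some i) (Some i) z
  + 2 * \sum_(i < N) a ord0 i * f2 (Some i) None z + f2 None None z <= 0.
Proof.
move=> df df1 cf cf1 cf2 a1 z0 zmax.
have Hz : H z by exact: ltW.
have fyy : f2 None None z <= 0.
  by apply: (Dz2_at_max df df1 cf cf1 cf2 Hz zmax); exact: (Dz_at_max df Hz zmax).
have a2 := sum_sqr_le1 a1.
have : \sum_(i < N) (f2 (Some i) (Some i) z + 2 * a ord0 i * f2 (Some i) None z
    + a ord0 i ^+ 2 * f2 None None z) <= 0.
  by apply: sumr_le0 => i _; exact: Dz2_mixed_at_max.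
rewrite !big_split /= -mulr_suml.
have -> : \sum_(i < N) 2 * a ord0 i * f2 (Some i) None z =
    2 * \sum_(i < N) a ord0 i * f2 (Some i) None z.
  by rewrite mulr_sumr; apply: eq_bigr => i _; rewrite mulrA.
move=> sle0.
have : 0 <= (1 - \sum_(i < N) a ord0 i ^+ 2) * - f2 None None z.
  by rewrite mulr_ge0// ?subr_ge0// oppr_ge0.
rewrite mulrBl mul1r mulrN opprK; move: sle0; lra.
Qed.

End EllipticMax.

(** * Boundary behaviour of the solution and the inequality at a spatial maximum *)

Section Solution.
Context {R : realType} {N : nat}.
Notation point := ('rV[R]_N * R)%type.
Notation H := (@closed_half_space R N).
Notation E := (@basis_vec R N).

Lemma continuous_tz_slice (I : set R) (f : R -> point -> R) (t : R) :
  continuous_tz I f -> I t -> {within H, continuous (f t)}.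
Proof.
move=> /subspace_continuousP cf It; apply/subspace_continuousP => z Hz.
have cs : (t, q) @[q --> within H (nbhs z)] --> within (I `*` H) (nbhs (t, z)).
  move=> B HB.
  have cp : (t, q) @[q --> z] --> (t, z).
    exact: (cvg_pair (cvg_cst t) cvg_id).
  have nB : nbhs z (fun q => (I `*` H) (t, q) -> B (t, q)) by exact: cp HB.
  suff : nbhs z (fun q => H q -> B (t, q)) by [].
  by apply: filterS nB => q + Hq; apply.
exact: cvg_comp cs (cf (t, z) (conj It Hz)).
Qed.

Lemma vertical_limit (g : point -> R) (x : 'rV[R]_N) :
  {within H, continuous g} -> g (x, y) @[y --> 0^'+] --> g (x, 0).
Proof.
move=> /subspace_continuousP cg.
have cs : (x, y) @[y --> (0 : R)^'+] --> within H (nbhs (x, 0)).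
  move=> B HB.
  have cp : (x, y) @[y --> (0 : R)] --> (x, 0 : R).
    exact: (cvg_pair (cvg_cst x) cvg_id).
  have nB : nbhs (0 : R) (fun y => H (x, y) -> B (x, y)) by exact: cp HB.
  suff : nbhs (0 : R) (fun y => 0 < y -> B (x, y)) by [].
  by apply: filterS nB => y + y0; apply; exact: ltW.
exact: cvg_comp cs (cg (x, 0) (lexx 0)).
Qed.

Section Slice.
Variables (I : set R) (c : R) (a : 'rV[R]_N) (u : R -> point -> R) (t : R).
Hypotheses (hc : 0 < c + 1) (hu : C12 I u) (heq : parabolic_eq I c a u)
  (hneu : neumann I c u) (It : I t).

Lemma solution_Dz k : is_Dz k (u t) (Dz k (u t)).
Proof. by move=> z Hz; have [_ _ h _] := hu; exact: (h k).1. Qed.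

Lemma solution_Dz2 k l : is_Dz k (Dz l (u t)) (Dz k (Dz l (u t))).
Proof. by move=> z Hz; have [_ _ _ h] := hu; exact: (h k l).1. Qed.

Lemma solution_continuous : {within H, continuous (u t)}.
Proof. by have [h _ _ _] := hu; exact: continuous_tz_slice h It. Qed.

Lemma solution_Dz_continuous k : {within H, continuous (Dz k (u t))}.
Proof. by have [_ _ h _] := hu; exact: continuous_tz_slice (h k).2 It. Qed.

Lemma solution_Dz2_continuous k l : {within H, continuous (Dz k (Dz l (u t)))}.
Proof. by have [_ _ _ h] := hu; exact: continuous_tz_slice (h k l).2 It. Qed.

(** The operator without its singular drift [c / y * D_y]; unlike [Lop] it is continuous up to
    [y = 0]. *)
Let regular_part (z : point) : R :=
  \sum_(i < N) Dz (Some i) (Dz (Some i) (u t)) z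
  + 2 * \sum_(i < N) a ord0 i * Dz (Some i) (Dz None (u t)) z
  + Dz None (Dz None (u t)) z.

Let regular_part_limit (x : 'rV[R]_N) :
  regular_part (x, y) @[y --> 0^'+] --> regular_part (x, 0).
Proof.
have lim2 k l := @vertical_limit _ x (@solution_Dz2_continuous k l).
apply: cvgD; last exact: lim2.
apply: cvgD.
  by apply: cvg_big => [|i _]; [exact: add_continuous|exact: lim2].
apply: cvgM; first exact: cvg_cst.
apply: cvg_big => [|i _]; first exact: add_continuous.
by apply: cvgM; [exact: cvg_cst|exact: lim2].
Qed.

(* For [c <= 0] the weight [y ^ c] is bounded below, so the Neumann condition
   itself gives the claim; for [c > 0] it is void, but [c / y * D_y u] must
   converge because all the other terms of [L u] do. *)
Lemma solution_Dy0 (x : 'rV[R]_N) : Dz None (u t) (x, 0) = 0.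
Proof.
have uyl := @vertical_limit _ x (@solution_Dz_continuous None).
have [c0|c0] := leP c 0.
  have nl := @hneu t It x.
  apply/eqP; rewrite -normr_le0 -oppr_ge0 -[leRHS]add0r.
  have dl : `|y `^ c * Dz None (u t) (x, y)| - `|Dz None (u t) (x, y)|
      @[y --> 0^'+] --> 0 - `|Dz None (u t) (x, 0)|.
    have := cvg_norm nl; rewrite normr0 => nl0.
    by apply: cvgB; [exact: nl0|exact: cvg_norm uyl].
  apply: (cvgr_to_ge dl); near=> y.
  have y0 : 0 < y by near: y; exact: nbhs_right_gt.
  have y1 : y < 1 by near: y; exact: nbhs_right_lt.
  rewrite subr_ge0 normrM ler_peMl// ger0_norm ?powR_ge0 //.
  (* [y ^ c = exp (c ln y) >= 1] because [c <= 0] and [ln y <= 0]. *)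
  rewrite /powR gt_eqF// -expR0 ler_expR mulr_le0//.
  by rewrite ln_le0// ltW.
have ql : c / y * Dz None (u t) (x, y) @[y --> 0^'+]
    --> Dt I u t (x, 0) - regular_part (x, 0).
  have [_ Ll] := heq It x.
  have bl : Lop c a (u t) (x, y) - regular_part (x, y) @[y --> 0^'+]
      --> Dt I u t (x, 0) - regular_part (x, 0).
    by apply: cvgB; [exact: Ll|exact: regular_part_limit].
  apply: cvg_trans bl; apply: near_eq_cvg; near=> y.
  by rewrite /= /Lop /regular_part /=; ring.
have yl : y / c @[y --> (0 : R)^'+] --> 0 / c.
  apply: cvgM; last exact: cvg_cst.
  by apply: cvg_at_right_filter; exact: cvg_id.
(* A convergent drift term multiplied by [y / c], which tends to 0, gives back [D_y u]. *)
have pl : y / c * (c / y * Dz None (u t) (x, y)) @[y --> 0^'+] --> (0 : R).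
  by have := cvgM yl ql; rewrite !mul0r; exact.
apply: (cvg_unique _ uyl); first exact: norm_hausdorff.
apply: cvg_trans pl; apply: near_eq_cvg; near=> y.
have y0 : 0 < y by near: y; exact: nbhs_right_gt.
by rewrite /=; field; rewrite !gt_eqF.
Unshelve. all: by end_near. Qed.

(** [D_y u] vanishes on the whole boundary, so its tangential difference quotients there are
    identically zero. *)
Lemma solution_mixed0 i (x : 'rV[R]_N) :
  Dz (Some i) (Dz None (u t)) (x, 0) = 0.
Proof.
have fr : free_in (Some i) (x, 0 : R) by rewrite /free_in /=.
have zH : \forall h \near (0 : R)^'+, H (h *: E (Some i) + (x, 0)).
  by apply: cvg_within; exact: free_near.
have ql := diff_quotient_right zH
  (@solution_Dz2 (Some i) None _ (free_in_closed fr)).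
apply: (cvg_unique _ ql); first exact: norm_hausdorff.
rewrite (_ : diff_quotient _ _ _ = cst 0); first exact: cvg_cst.
apply/funext => h; rewrite /diff_quotient.
have -> : h *: E (Some i) + (x, 0) = (h *: delta_mx ord0 i + x, 0).
  by rewrite [LHS]surjective_pairing /= scaler0 addr0.
by rewrite !solution_Dy0 subrr mulr0.
Qed.

(** Since [D_y u] vanishes at [(x, 0)], the drift [c / y * D_y u] is [c] times the difference
    quotient of [D_y u] there, and tends to [c * D_yy u]. *)
Lemma parabolic_boundary (x : 'rV[R]_N) :
  Dt I u t (x, 0) = \sum_(i < N) Dz (Some i) (Dz (Some i) (u t)) (x, 0)
    + (1 + c) * Dz None (Dz None (u t)) (x, 0).
Proof.
have zH : \forall h \near (0 : R)^'+, H (h *: E None + (x, 0)).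
  near=> h; rewrite /closed_half_space /= addr0 /GRing.scale /= mulr1.
  by near: h; exact: nbhs_right_ge.
have ql := diff_quotient_right zH (@solution_Dz2 None None (x, 0) (lexx 0)).
have [_ Ll] := heq It x.
apply: (cvg_unique _ Ll); first exact: norm_hausdorff.
have -> : \sum_(i < N) Dz (Some i) (Dz (Some i) (u t)) (x, 0)
    + (1 + c) * Dz None (Dz None (u t)) (x, 0)
    = regular_part (x, 0) + c * Dz None (Dz None (u t)) (x, 0).
  rewrite /regular_part [X in 2 * X]big1 ?mulr0 ?addr0; first by ring.
  by move=> i _; rewrite solution_mixed0 mulr0.
have sl : regular_part (x, y) + c * diff_quotient (Dz None (u t)) (x, 0) (E None) y
    @[y --> 0^'+] --> regular_part (x, 0) + c * Dz None (Dz None (u t)) (x, 0).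
  apply: cvgD; first exact: regular_part_limit.
  by apply: cvgM; [exact: cvg_cst|exact: ql].
apply: cvg_trans sl; apply: near_eq_cvg; near=> y.
have hE : (y *: E None + (x, 0)) = (x, y).
  by rewrite [LHS]surjective_pairing /= scaler0 add0r addr0 /GRing.scale /= mulr1.
by rewrite /= /diff_quotient hE solution_Dy0 subr0 /Lop /regular_part /=; ring.
Unshelve. all: by end_near. Qed.

(** The right side dominates [e] times the operator applied to the Gaussian, in the interior and on
    the boundary alike. The factor 8 is twice the 4 of the pure second derivatives, leaving room for
    the mixed terms. *)
Lemma parabolic_at_max (s e A g : R) (z : point) :
  enorm a < 1 -> 0 <= e -> H z ->
  (forall q, H q -> s * u t q - e * gauss A g q <= s * u t z - e * gauss A g z) ->
  s * Dt I u t z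
    <= e * ((8 * g ^+ 2 * sqnorm z + 2 * g * (N%:R + 1 + c)) * gauss A g z).
Proof.
move=> a1 e0 Hz zmax.
pose f q := s * u t q - e * gauss A g q.
pose f1 k q := s * Dz k (u t) q - e * gauss1 A g k q.
pose f2 k l q := s * Dz k (Dz l (u t)) q - e * gauss2 A g k l q.
have df k : is_Dz k f (f1 k).
  by move=> q Hq; apply: diff_quotient_lin; [exact: solution_Dz|exact: gauss_Dz].
have df1 k l : is_Dz k (f1 l) (f2 k l).
  by move=> q Hq; apply: diff_quotient_lin; [exact: solution_Dz2|exact: gauss1_Dz].
have clin (h : point -> R) (h' : point -> R) : {within H, continuous h} ->
    continuous h' -> {within H, continuous (fun q => s * h q - e * h' q)}.
  move=> ch ch' q; have ch'' := continuous_subspaceT ch'.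
  by apply: cvgB; apply: cvgM; try exact: cvg_cst; [exact: ch|exact: ch''].
have cf : {within H, continuous f}.
  by apply: clin; [exact: solution_continuous|exact: gauss_continuous].
have cf1 k : {within H, continuous (f1 k)}.
  by apply: clin; [exact: solution_Dz_continuous|exact: gauss1_continuous].
have cf2 k l : {within H, continuous (f2 k l)}.
  by apply: clin; [exact: solution_Dz2_continuous|exact: gauss2_continuous].
have P0 : 0 < gauss A g z by exact: expR_gt0.
have eP0 : 0 <= e * gauss A g z by rewrite mulr_ge0// ltW.
have sum_xx : \sum_(i < N) gauss2 A g (Some i) (Some i) z =
   (4 * g ^+ 2 * \sum_(i < N) z.1 ord0 i ^+ 2 + 2 * g * N%:R) * gauss A g z.
  transitivity (\sum_(i < N) (4 * g ^+ 2 * z.1 ord0 i ^+ 2 + 2 * g * 1) * gauss A g z).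
    by apply: eq_bigr => i _; rewrite /gauss2 eqxx /=; ring.
  by rewrite -mulr_suml big_split /= -!mulr_sumr sumr_const card_ord.
have sf2 : \sum_(i < N) f2 (Some i) (Some i) z =
    s * \sum_(i < N) Dz (Some i) (Dz (Some i) (u t)) z
    - e * \sum_(i < N) gauss2 A g (Some i) (Some i) z.
  by rewrite !mulr_sumr -sumrB.
have [z0|z0] := ltP 0 z.2.
  have zE : z = (z.1, z.2) by case: (z).
  have ell := elliptic_at_max df df1 cf cf1 cf2 a1 z0 zmax.
  have f1y : f1 None z = 0 by exact: (Dz_at_max df Hz zmax).
  have sm : \sum_(i < N) a ord0 i * f2 (Some i) None z =
     s * \sum_(i < N) a ord0 i * Dz (Some i) (Dz None (u t)) z
     - e * (4 * g ^+ 2 * z.2 * (\sum_(i < N) a ord0 i * z.1 ord0 i) * gauss A g z).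
    rewrite [4 * _ * _ * _]mulr_sumr mulr_suml !mulr_sumr -sumrB.
    by apply: eq_bigr => i _; rewrite /f2 /gauss2 /=; ring.
  have a2 := sum_sqr_le1 a1.
  (* Expanding [(x_i - y a_i)^2 >= 0], summing over [i] and using [|a|^2 <= 1]. *)
  have cs : 2 * z.2 * \sum_(i < N) a ord0 i * z.1 ord0 i <= sqnorm z.
    rewrite sqnormE.
    have : \sum_(i < N) 2 * z.2 * (a ord0 i * z.1 ord0 i) <=
       \sum_(i < N) (z.1 ord0 i ^+ 2 + z.2 ^+ 2 * a ord0 i ^+ 2).
      apply: ler_sum => i _.
      have := sqr_ge0 (z.1 ord0 i - z.2 * a ord0 i); lra.
    rewrite -mulr_sumr big_split /= -mulr_sumr => /le_trans; apply.
    by rewrite lerD2l ler_piMr// sqr_ge0.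
  have [heqz _] := heq It z.1.
  rewrite zE (heqz _ z0) -zE /Lop.
  (* At the maximum [s D_y u] equals [e] times the [y]-derivative of the Gaussian, whose factor [y]
     cancels the singularity. *)
  have yy : c / z.2 * (s * Dz None (u t) z) = e * (2 * g * c * gauss A g z).
    have -> : s * Dz None (u t) z = e * gauss1 A g None z.
      by apply/eqP; rewrite -subr_eq0; apply/eqP.
    by rewrite /gauss1 /=; field; rewrite gt_eqF.
  have key : e * gauss A g z * (4 * g ^+ 2 * (2 * z.2 * \sum_(i < N) a ord0 i * z.1 ord0 i))
     <= e * gauss A g z * (4 * g ^+ 2 * sqnorm z).
    by rewrite ler_wpM2l// ler_wpM2l// mulr_ge0// sqr_ge0.
  move: ell; rewrite sf2 sm sum_xx /f2 /gauss2 /= => ell.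
  move: key yy ell; rewrite sqnormE.
  lra.
have z20 : z.2 = 0 by apply/eqP; rewrite eq_le z0.
have zE : z = (z.1, 0) by rewrite -z20; case: (z).
(* Here [y] is a one-sided direction: the derivative vanishes by [solution_Dy0] and the factor [y]
   in [gauss1], not by maximality. *)
have f1y : f1 None z = 0.
  by rewrite /f1 zE solution_Dy0 /gauss1 /= !mulr0 mul0r mulr0 subr0.
have fyy : f2 None None z <= 0 by exact: (Dz2_at_max df df1 cf cf1 cf2 Hz zmax).
have fxx : \sum_(i < N) f2 (Some i) (Some i) z <= 0.
  apply: sumr_le0 => i _; apply: (Dz2_at_max df df1 cf cf1 cf2 Hz zmax).
  exact: (Dz_at_max df Hz zmax).
rewrite [in leLHS]zE parabolic_boundary -zE.
have cyy : (1 + c) * f2 None None z <= 0.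
  by rewrite mulr_ge0_le0// addrC ltW.
have q0 : 0 <= e * gauss A g z * (4 * g ^+ 2 * sqnorm z).
  by rewrite mulr_ge0// mulr_ge0 ?addr_ge0 ?sqr_ge0// mulr_ge0// sqr_ge0.
move: fxx cyy q0; rewrite sf2 sum_xx /f2 /gauss2 /= sqnormE z20.
lra.
Qed.

End Slice.
End Solution.

(** * Compact boxes and the time-dependent barrier *)

Section Comparison.
Context {R : realType} {N : nat}.
Notation point := ('rV[R]_N * R)%type.
Notation H := (@closed_half_space R N).

Lemma sqnorm_ge0 (z : point) : 0 <= sqnorm z.
Proof. by rewrite addr_ge0 ?sqr_ge0. Qed.

Definition box (r : R) : set point :=
  [set x : 'rV[R]_N | forall i, `[(- r), r]%classic (x ord0 i)] `*` `[0, r].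

Lemma box_compact (r : R) : compact (box r).
Proof.
apply: compact_setX; last exact: segment_compact.
exact: (rV_compact (A := fun=> `[(- r), r]%classic) (fun=> @segment_compact R _ _)).
Qed.

Lemma sqnorm_outside_box (r : R) (z : point) :
  0 <= r -> H z -> ~ box r z -> r ^+ 2 <= sqnorm z.
Proof.
move=> r0 Hz; rewrite leNgt; apply: contra_notN => zr.
have small (x : R) : x ^+ 2 <= sqnorm z -> `|x| <= r.
  move=> xz; rewrite -(ler_pXn2r (n := 2)) ?nnegrE// real_normK ?num_real//.
  by rewrite (le_trans xz)// ltW.
have sum0 : 0 <= \sum_(j < N) z.1 ord0 j ^+ 2.
  by apply: sumr_ge0 => j _; exact: sqr_ge0.
split => [i|] /=.
  rewrite in_itv /= -ler_norml; apply: small; rewrite sqnormE.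
  rewrite (bigD1 i) //= -addrA lerDl addr_ge0 ?sqr_ge0//.
  by apply: sumr_ge0 => j _; exact: sqr_ge0.
rewrite in_itv /=; apply/andP; split; first exact: Hz.
by apply: le_trans (ler_norm _) _; apply: small; rewrite sqnormE lerDr.
Qed.

Section TimeGauss.
Variables (k b m t0 : R).

(** The Gaussian rate starts at [2 * b], twice the growth rate of the solution when [b = beta]. Its
    linear increase gives the time derivative a term in [sqnorm z] to absorb the one coming from the
    space operator. *)
Definition barrier (t : R) (z : point) : R :=
  gauss (k * (t - t0)) (2 * b * (1 + m * (t - t0))) z.

Lemma barrier_Dt (D : set R) (t : R) (z : point) :
  diff_quotient (barrier^~ z) t 1 h @[h --> within (increments D t 1) 0^']
    --> (k + 2 * b * m * sqnorm z) * barrier t z.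
Proof.
apply: cvg_within_filter; apply: diff_quotient_derive.
have d : is_derive (0 : R) 1 (fun s : R => k * (s + t - t0)
    + 2 * b * (1 + m * (s + t - t0)) * sqnorm z) (k + 2 * b * m * sqnorm z).
  by apply: is_derive_eq; rewrite /GRing.scale /=; ring.
have -> : (fun s : R => barrier (s *: (1 : R) + t) z) = expR \o (fun s : R =>
    k * (s + t - t0) + 2 * b * (1 + m * (s + t - t0)) * sqnorm z).
  by apply: funext => s; have hE : s *: (1 : R) = s := mulr1 s; rewrite hE.
rewrite [X in is_derive _ _ _ X]mulrC /barrier /gauss -[in expR _](add0r t).
exact: is_derive1_comp (is_derive_expR _) d.
Qed.

Lemma barrier_continuous :
  continuous (fun p : R * point => barrier p.1 p.2).
Proof.
move=> p; apply: continuous_comp; last exact: continuous_expR.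
have cf : (q.1 - t0) @[q --> p] --> p.1 - t0.
  by apply: cvgB; [exact: cvg_fst|exact: cvg_cst].
apply: cvgD; first by apply: cvgM; [exact: cvg_cst|exact: cf].
apply: cvgM.
  apply: cvgM; first exact: cvg_cst.
  apply: cvgD; first exact: cvg_cst.
  by apply: cvgM; [exact: cvg_cst|exact: cf].
exact: (continuous_comp (f := snd) (g := @sqnorm R N) (@cvg_snd _ _ _ _ _)
  (@sqnorm_continuous R N p.2)).
Qed.

Lemma barrier_ge (t : R) (z : point) : 0 <= k -> 0 <= b -> 0 <= m -> t0 <= t ->
  expR (2 * b * sqnorm z) <= barrier t z.
Proof.
move=> k0 b0 m0 tt; rewrite /barrier /gauss ler_expR.
have q0 := sqnorm_ge0 z; have d0 : 0 <= t - t0 by rewrite subr_ge0.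
have := mulr_ge0 k0 d0.
have : 0 <= 2 * b * (m * (t - t0)) * sqnorm z by rewrite !mulr_ge0.
lra.
Qed.

End TimeGauss.

(** * The maximum principle on a short time window and its iteration *)

Section Step.
Variables (c : R) (a : 'rV[R]_N) (T : R) (u : R -> point -> R) (beta C : R).
Hypotheses (hc : 0 < c + 1) (ha : enorm a < 1)
  (hC12 : C12 `]0, T] u) (hC : continuous_tz `[0, T] u)
  (heq : parabolic_eq `]0, T] c a u) (hneumann : neumann `]0, T] c u)
  (hbeta : 0 < beta) (hCpos : 0 < C)
  (hgrowth : forall (t : R) (z : point), t \in `[0, T] ->
     H z -> `|u t z| <= C * expR (beta * sqnorm z)).

(* The rate [64 beta] makes the exponent of the barrier grow fast enough,
   [8 g^2 <= g'] for [g = 2 beta (1 + 64 beta (t - ts))], as long as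
   [g <= 4 beta], i.e. up to time [ts + 1 / (64 beta)]. *)
Let k : R := 8 * beta * (N%:R + 1 + c) + 1.
Let m : R := 64 * beta.

Let dim_gt0 : 0 < N%:R + 1 + c.
Proof. by rewrite -addrA ltr_wpDl // addrC. Qed.

Let k_gt0 : 0 < k.
Proof. by rewrite ltr_wpDl // mulr_ge0 ?mulr_ge0 // ltW. Qed.

Lemma comparison_step (ts te s e : R) :
  0 <= ts -> te <= T -> m * (te - ts) <= 1 ->
  (forall z, H z -> u ts z = 0) -> 0 < e ->
  forall (t : R) (z : point), t \in `[ts, te] -> H z ->
    s * u t z <= e * barrier k beta m ts t z.
Proof.
move=> ts0 teT mt uts e0 t1 z1 t1I Hz1.
pose w (p : R * point) := s * u p.1 p.2 - e * barrier k beta m ts p.1 p.2.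
rewrite -subr_le0 -[leLHS]/(w (t1, z1)) leNgt; apply/negP => w1.
have b0 := ltW hbeta; have m0 : 0 <= m by rewrite mulr_ge0.
have inT t : t \in `[ts, te] -> t \in `[0, T].
  by rewrite !in_itv /= => /andP[t0 tt]; rewrite (le_trans ts0 t0) (le_trans tt teT).
(* For [q >= r ^+ 2] one gets [|s| C <= e beta r <= e beta q <= e exp (beta q)], using
   [r <= r ^+ 2]; hence the barrier wins outside the box of size [r]. *)
pose r : R := 1 + `|s| * C / (e * beta).
have eb0 : 0 < e * beta by rewrite mulr_gt0.
have r1 : 1 <= r by rewrite lerDl divr_ge0 ?(ltW eb0)// mulr_ge0// ltW.
have outside t z : t \in `[ts, te] -> H z -> ~ box r z -> w (t, z) <= 0.
  move=> tI Hz zr; have := sqnorm_outside_box (le_trans ler01 r1) Hz zr.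
  set q := sqnorm z => rq.
  rewrite subr_le0 /=.
  apply: (@le_trans _ _ (`|s| * (C * expR (beta * q)))).
    apply: le_trans (ler_norm _) _; rewrite normrM ler_wpM2l//.
    exact: hgrowth (inT t tI) Hz.
  apply: (@le_trans _ _ (e * expR (2 * beta * q))); last first.
    rewrite ler_pM2l//; apply: barrier_ge => //; first exact: ltW.
    by move: tI; rewrite in_itv /= => /andP[].
  rewrite (_ : 2 * beta * q = beta * q + beta * q); last by ring.
  rewrite expRD 2!mulrA ler_wpM2r ?expR_ge0//.
  have rr : r <= q by apply: le_trans rq; rewrite expr2 ler_peMr// (le_trans ler01).
  have sr : `|s| * C <= e * beta * r.
    rewrite /r mulrDr mulr1 mulrCA divff ?gt_eqF// mulr1 lerDr; exact: ltW.
  apply: (le_trans sr); rewrite -mulrA ler_pM2l//.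
  apply: (@le_trans _ _ (beta * q)); first by rewrite ler_pM2l.
  by apply: le_trans (expR_ge1Dx _); rewrite lerDr.
pose K : set (R * point) := `[ts, te] `*` box r.
have K1 : K (t1, z1).
  split => //=; apply: contrapT => /(outside _ _ t1I Hz1).
  by rewrite leNgt w1.
have boxH z : box r z -> H z.
  by move=> [_] /=; rewrite in_itv /= => /andP[].
have cK : compact K.
  by apply: compact_setX; [exact: segment_compact|exact: box_compact].
have cw : {within K, continuous w}.
  have KT : K `<=` `[0, T] `*` H.
    by move=> [t z] [/= tI /boxH zH]; split => //=; exact: inT.
  have cu := continuous_subspaceW KT hC.
  have cb := continuous_subspaceT (@barrier_continuous k beta m ts).
  move=> p; apply: cvgB; apply: cvgM; try exact: cvg_cst.
    exact: cu.
  exact: cb.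
have [[t0 z0] + wmax] := compact_EVT_max (ex_intro _ _ K1) cK cw.
rewrite inE => -[/= t0I /boxH Hz0].
have w0 : 0 < w (t0, z0).
  by apply: lt_le_trans w1 _; apply: wmax; rewrite inE.
have wmax' t z : t \in `[ts, te] -> H z -> w (t, z) <= w (t0, z0).
  move=> tI Hz; have [zr|zr] := pselect (box r z).
    by apply: wmax; rewrite inE; split.
  exact: le_trans (outside t z tI Hz zr) (ltW w0).
have P0 t z : 0 < barrier k beta m ts t z by exact: expR_gt0.
(* At time [ts] the solution vanishes and [w] is nonpositive, so a positive maximum lies strictly
   later. *)
have [tst0 t0te] : ts < t0 /\ t0 <= te.
  move: t0I; rewrite in_itv /= => /andP[t0l t0r]; split=> //.
  move: t0l; rewrite le_eqVlt => /predU1P[t0E|//].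
  move: w0; rewrite /w /= -t0E uts// mulr0 sub0r oppr_gt0.
  by rewrite ltNge mulr_ge0 // ltW.
have It0 : `]0, T]%classic t0.
  by rewrite /= in_itv /= (le_lt_trans ts0) //= (le_trans t0te).
have space := @parabolic_at_max R N _ c a u t0 hc hC12 heq hneumann It0 s e
  (k * (t0 - ts)) (2 * beta * (1 + m * (t0 - ts))) z0 ha (ltW e0) Hz0
  (fun q Hq => wmax' t0 q t0I Hq).
have near_t : \forall h \near (0 : R)^'-, ts < h + t0.
  near=> h; suff : ts - t0 < h by lra.
  by near: h; apply: nbhs_left_gt; rewrite subr_lt0.
have inI : \forall h \near (0 : R)^'-, `]0, T]%classic (h *: (1 : R) + t0).
  near=> h.
  have h0 : h < 0 by near: h; exact: nbhs_left_lt.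
  have th : ts < h + t0 by near: h.
  have hE : h *: (1 : R) = h := mulr1 h.
  rewrite /= hE in_itv /=; apply/andP; split; first exact: le_lt_trans th.
  by move: t0te teT h0; lra.
have Dtu : diff_quotient (u^~ z0) t0 1 h @[h --> within
    (increments `]0, T]%classic t0 1) 0^'] --> Dt `]0, T] u t0 z0.
  by have [_ [h _] _ _] := hC12; exact: h.
have time := diff_quotient_left inI
  (diff_quotient_lin (s := s) (e := e) Dtu (@barrier_Dt k beta m ts _ t0 z0)).
(* For [h < 0] the increment of [w] from its maximum is nonpositive, so the quotient is
   nonnegative. *)
have time0 : 0 <= s * Dt `]0, T] u t0 z0
   - e * ((k + 2 * beta * m * sqnorm z0) * barrier k beta m ts t0 z0).
  apply: (cvgr_to_ge time); near=> h.
  have h0 : h < 0 by near: h; exact: nbhs_left_lt.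
  have th : ts < h + t0 by near: h.
  have hE : h *: (1 : R) = h := mulr1 h.
  rewrite /diff_quotient nmulr_rge0 ?invr_lt0// subr_le0 hE.
  apply: (wmax' (h + t0)) => //; rewrite in_itv /= (ltW th) /=.
  by move: t0te h0; lra.
set P := barrier k beta m ts t0 z0 in time0 space.
have {time0 space} : (k + 2 * beta * m * sqnorm z0) * P <=
   (8 * (2 * beta * (1 + m * (t0 - ts))) ^+ 2 * sqnorm z0
    + 2 * (2 * beta * (1 + m * (t0 - ts))) * (N%:R + 1 + c)) * P.
  rewrite -(ler_pM2l e0); apply: le_trans space.
  by rewrite -subr_ge0.
rewrite ler_pM2r; last exact: P0.
set g := 2 * beta * (1 + m * (t0 - ts)).
have q0 := sqnorm_ge0 z0.
have mt0 : 0 <= m * (t0 - ts) <= 1.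
  rewrite mulr_ge0 ?subr_ge0 ?(ltW tst0)//=; apply: le_trans mt.
  by rewrite ler_wpM2l// lerD2r.
have [g0 g4] : 0 <= g /\ g <= 4 * beta.
  move/andP: mt0 => [m1 m2]; split; first by rewrite /g !mulr_ge0 // addr_ge0.
  rewrite /g -mulrA (_ : 4 * beta = 2 * (beta * 2)); last by ring.
  by rewrite ler_pM2l// ler_pM2l//; lra.
have g2 : 8 * g ^+ 2 <= 2 * beta * m.
  rewrite (_ : 2 * beta * m = 8 * (4 * beta) ^+ 2); last by rewrite /m; ring.
  by rewrite ler_pM2l// ler_pXn2r// nnegrE mulr_ge0.
(* The quadratic terms compare by [g2], and [2 g (N + 1 + c) <= k - 1]: the [+ 1] in [k] makes the
   contradiction strict. *)
have := ler_wpM2r q0 g2.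
have := ler_wpM2r (ltW dim_gt0) g4.
rewrite /k; lra.
Unshelve. all: by end_near. Qed.

Lemma vanishing_step (ts te : R) :
  0 <= ts -> te <= T -> m * (te - ts) <= 1 ->
  (forall z, H z -> u ts z = 0) ->
  forall (t : R) (z : point), t \in `[ts, te] -> H z -> u t z = 0.
Proof.
move=> ts0 teT mt uts t z tI Hz.
have le0 (s : R) : s * u t z <= 0.
  rewrite leNgt; apply/negP => su.
  have P0 : 0 < barrier k beta m ts t z by exact: expR_gt0.
  (* With this [e] the comparison reads [s u <= s u / 2], impossible for [s u > 0]. *)
  have e0 : 0 < s * u t z / 2 / barrier k beta m ts t z by rewrite !divr_gt0.
  have := comparison_step s ts0 teT mt uts e0 tI Hz.
  by rewrite divfK ?gt_eqF//; lra.
by have := le0 1; have := le0 (-1); lra.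
Qed.

Lemma vanishing (hinit : forall z : point, 0 < z.2 -> u 0 z = 0) (t : R)
  (z : point) : t \in `[0, T] -> H z -> u t z = 0.
Proof.
move=> tT Hz.
have T0 : 0 <= T by move: tT; rewrite in_itv /= => /andP[/le_trans]; exact.
(* The initial condition covers only [y > 0]; continuity at time 0 extends it to [y = 0]. *)
have u0 q : H q -> u 0 q = 0.
  case: q => x y Hq; have := Hq; rewrite /closed_half_space /= le_eqVlt.
  move=> /predU1P[<-|]; last exact: (hinit (x, y)).
  have I0 : `[0, T]%classic (0 : R) by rewrite /= in_itv /= lexx.
  have ul := vertical_limit (x := x) (continuous_tz_slice hC I0).
  apply: (cvg_unique _ ul); first exact: norm_hausdorff.
  have zl : (fun=> 0 : R) y @[y --> (0 : R)^'+] --> (0 : R) by exact: cvg_cst.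
  apply: cvg_trans zl; apply: near_eq_cvg; near=> h; apply/esym/hinit => /=.
  by near: h; exact: nbhs_right_gt.
have m0 : 0 < m by rewrite mulr_gt0.
(* Induction over windows of length [1 / m]: the step restarts from time [n / m], where the solution
   is already known to vanish. *)
suff steps n : forall t, t \in `[0, T] -> m * t <= n%:R ->
    forall q, H q -> u t q = 0.
  apply: (steps (Num.bound (m * t)) t) => //.
  apply/ltW/archi_boundP; rewrite mulr_ge0 ?(ltW m0)//.
  by move: tT; rewrite in_itv /= => /andP[].
elim: n => [|n IHn] {tT Hz z}t; rewrite in_itv /= => /andP[t0 tT] mt q Hq.
  have -> : t = 0; last exact: u0.
  apply/eqP; rewrite eq_le t0 andbT.
  by rewrite -(pmulr_rle0 _ m0).
have [mtn|mtn] := leP (m * t) n%:R.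
  by apply: IHn mtn _ Hq; rewrite in_itv /= t0.
have tn : n%:R / m < t by rewrite ltr_pdivrMr// mulrC.
have n0 : 0 <= n%:R / m by rewrite divr_ge0 // ltW.
apply: (vanishing_step n0 tT) Hq => [||].
- by rewrite mulrBr mulrCA divff ?gt_eqF// mulr1 lerBlDr addrC natr1.
- move=> q' Hq'; apply: IHn => //.
    by rewrite in_itv /= n0 (le_trans (ltW tn)).
  by rewrite mulrCA divff ?gt_eqF// mulr1.
- by rewrite in_itv /= (ltW tn) lexx.
Unshelve. all: by end_near. Qed.

End Step.
End Comparison.

Theorem theorem3p5 (R : realType) (N : nat) (c : R) (a : 'rV[R]_N)
    (hc : 0 < c + 1) (ha : enorm a < 1)
    (T : R) (hT : 0 < T) (u : R -> 'rV[R]_N * R -> R)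
    (hC12 : C12 `]0, T] u)
    (hC : continuous_tz `[0, T] u)
    (heq : parabolic_eq `]0, T] c a u)
    (hinit : forall z : 'rV[R]_N * R, 0 < z.2 -> u 0 z = 0)
    (hneumann : neumann `]0, T] c u)
    (beta C : R) (hbeta : 0 < beta) (hCpos : 0 < C)
    (hgrowth : forall (t : R) (z : 'rV[R]_N * R), t \in `[0, T] ->
       closed_half_space z -> `|u t z| <= C * expR (beta * sqnorm z)) :
  forall (t : R) (z : 'rV[R]_N * R), t \in `[0, T] ->
    closed_half_space z -> u t z = 0.

Proof.
by move=> t z; exact: (vanishing hc ha hC12 hC heq hneumann hbeta hCpos hgrowth hinit).
Qed.
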